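(* Let $m\ge1$, $N\ge2$, and let $A\subset\mathbb{R}^m$ be a nonempty open bounded set with Lipschitz boundary. Let $\delta_j>0$ be spacing parameters with $\delta_j\to0$ and let $u_j:\mathbb{Z}_{\delta_j}(A)\to\mathcal{S}^{N-1}$ be a sequence of discrete functions. Suppose that $u_j\rightharpoonup^* u$ in $L^\infty(A,B_1^N)$ and that the average of $u$ on $A$ satisfies $|\langle u\rangle_A|<1$. Then, for all $j$, there exist $\tilde u_j:\mathbb{Z}_{\delta_j}(A)\to\mathcal{S}^{N-1}$ and integers $P_j\ge0$ such that 1. the discrete average $\langle\tilde u_j\rangle_A^d:=\dfrac{1}{\#\mathbb{Z}_{\delta_j}(A)}\displaystyle\sum_{i\in\mathbb{Z}_{\delta_j}(A)}\tilde u_j(i)$ is equal to $\langle u\rangle_A$; 2. the function $\tilde u_j$ is obtained by modifying the function $u_j$ in at most $2P_j$ points, with $\dfrac{P_j}{\#\mathbb{Z}_{\delta_j}(A)}\to0$ as $j\to\infty$.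
   Context: $\mathcal{S}^{N-1}$ is the unit sphere of $\mathbb{R}^N$ and $B_1^N$ the closed unit ball of $\mathbb{R}^N$. For $\delta>0$, $\mathbb{Z}_\delta(A)=\{\alpha\in\delta\mathbb{Z}^m:(\alpha+[0,\delta)^m)\cap A\neq\emptyset\}$, and $\#$ denotes the number of elements of a set. A discrete function $v:\mathbb{Z}_\delta(A)\to\mathcal{S}^{N-1}$ is identified with its piecewise-constant extension, equal to $v(\alpha)$ on $\alpha+[0,\delta)^m$ for $\alpha\in\mathbb{Z}_\delta(A)$; the convergence $u_j\rightharpoonup^*u$ is weak$^*$ convergence in $L^\infty$ on $A$ of these extensions. The average of $u$ is $\langle u\rangle_A=\frac1{|A|}\int_A u(x)\,dx$.
   Formalization: The equality of the discrete average with the average of u is asserted only for those j for which Z_{delta_j}(A) has at least two points, since with a single point the discrete average is a unit vector and cannot have norm less than 1. *)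

(* Defs.v *)
(* R^n is 'rV[R]_n over R : realType. *)
From HB Require Import structures.
From mathcomp Require Import all_boot all_order all_algebra finmap.
From mathcomp Require Import all_classical all_reals all_analysis.
Import numFieldNormedType.Exports.
Set Implicit Arguments.
Unset Strict Implicit.
Unset Printing Implicit Defensive.
Import Order.TTheory GRing.Theory Num.Theory.
Local Open Scope classical_set_scope.
Local Open Scope ring_scope.

(* The canonical norm of 'rV[R]_n is the sup norm; spheres and balls of the
   target space need the Euclidean one. *)
Definition dotv (R : realType) n (x y : 'rV[R]_n) : R :=
  \sum_(i < n) x 0 i * y 0 i.

Definition enorm (R : realType) n (x : 'rV[R]_n) : R := Num.sqrt (dotv x x).

(* Product sigma-algebra (i.e. the Borel one) on 'rV[R]_n: the smallest one
   making the coordinates measurable, as the library does for n.-tuple T. *)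
Definition rV_display : measure_display.
Proof. exact: default_measure_display. Qed.

Section measurable_rV.
Context {R : realType} {n : nat}.

Let coor : 'I_n -> 'rV[R]_n -> measurableTypeR R := fun i x => x 0 i.

Let rV_set0 : g_sigma_preimage coor set0.
Proof. exact: sigma_algebra0. Qed.

Let rV_setC A : g_sigma_preimage coor A -> g_sigma_preimage coor (~` A).
Proof. exact: sigma_algebraC. Qed.

Let rV_bigcup (F : _^nat) : (forall i, g_sigma_preimage coor (F i)) ->
  g_sigma_preimage coor (\bigcup_i (F i)).
Proof. exact: sigma_algebra_bigcup. Qed.

HB.instance Definition _ := @isMeasurable.Build rV_display
  'rV[R]_n (g_sigma_preimage coor) rV_set0 rV_setC rV_bigcup.

Lemma measurable_coor (i : 'I_n) :
  measurable_fun [set: 'rV[R]_n] (fun x : 'rV[R]_n => x 0 i : measurableTypeR R).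
Proof.
move=> _ Y mY; rewrite setTI; apply: sub_sigma_algebra => /=.
rewrite -bigcup_seq/=; exists i => /=; first by rewrite mem_index_enum.
by exists Y => //; rewrite setTI.
Qed.

Lemma measurable_fun_rVP d (T : measurableType d) (f : T -> 'rV[R]_n) :
  measurable_fun [set: T] f <->
  forall i, measurable_fun [set: T] (fun t => f t 0 i : measurableTypeR R).
Proof.
split=> [mf i|mf].
  exact: (measurableT_comp (measurable_coor i) mf).
move=> _; apply: (@smallest_sub _ _ _ [set B | measurable (setT `&` f @^-1` B)]).
  split => /=.
  - by rewrite preimage_set0 setI0.
  - move=> B mB; rewrite setTD setTI preimage_setC; apply: measurableC.
    by rewrite -[X in measurable X]setTI.
  - move=> F mF; rewrite setTI preimage_bigcup; apply: bigcup_measurable => k _.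
    by rewrite -[X in measurable X]setTI.
rewrite -bigcup_seq => B [i _ [C mC <-]] /=.
by rewrite setTI; apply: (mf i).
Qed.

End measurable_rV.

Section lebesgue_step.
Context (R : realType) (n : nat).
Let R1 : measurableType _ := measurableTypeR R.

Definition consV (p : R1 * 'rV[R]_n) : 'rV[R]_n.+1 :=
  \row_(i < n.+1) oapp (p.2 0) p.1 (unlift ord0 i).

Definition unconsV (x : 'rV[R]_n.+1) : R1 * 'rV[R]_n :=
  (x 0 ord0, \row_(i < n) x 0 (lift ord0 i)).

Lemma consVK : cancel consV unconsV.
Proof.
case=> a v; rewrite /unconsV /consV/= mxE unlift_none; congr pair.
by apply/rowP => i; rewrite !mxE liftK.
Qed.

Lemma measurable_consV : measurable_fun [set: R1 * 'rV[R]_n] consV.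
Proof.
apply/measurable_fun_rVP => i; under eq_fun do rewrite mxE.
have [j _|_] /= := unliftP ord0 i; last exact: measurable_fst.
exact: (measurableT_comp (measurable_coor j) measurable_snd).
Qed.

Lemma measurable_unconsV : measurable_fun [set: 'rV[R]_n.+1] unconsV.
Proof.
apply/measurable_fun_pairP; split; first exact: (measurable_coor ord0).
apply/measurable_fun_rVP => i; under eq_fun do rewrite mxE.
exact: (measurable_coor (lift ord0 i)).
Qed.

Variable mu : {sigma_finite_measure set 'rV[R]_n -> \bar R}.

Definition lebesgue_step : set 'rV[R]_n.+1 -> \bar R :=
  pushforward (@lebesgue_measure R \x mu)%E consV.

Let step0 : lebesgue_step set0 = 0%E.
Proof. by rewrite /lebesgue_step /pushforward preimage_set0 measure0. Qed.

Let step_ge0 A : (0 <= lebesgue_step A)%E.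
Proof. exact: (measure_ge0 (product_measure1 (@lebesgue_measure R) mu)). Qed.

Let step_sigma_additive : semi_sigma_additive lebesgue_step.
Proof.
exact: (@measure_semi_sigma_additive _ _ _
  (measure_function_pushforward__canonical__measure_function_Measure
    (product_measure1 (@lebesgue_measure R) mu) measurable_consV)).
Qed.

HB.instance Definition _ := isMeasure.Build _ _ _ lebesgue_step
  step0 step_ge0 step_sigma_additive.

Let step_sigma_finite : sigma_finite setT lebesgue_step.
Proof.
have /sigma_finiteP[F [FT ndF Foo]] := sigma_finiteT (@lebesgue_measure R).
have /sigma_finiteP[G [GT ndG Goo]] := sigma_finiteT mu.
exists (fun k => unconsV @^-1` (F k `*` G k)).
  apply/esym/seteqP; split => // x _.
  have : (\bigcup_k F k) (x 0 ord0) by rewrite -FT.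
  have : (\bigcup_k G k) (unconsV x).2 by rewrite -GT.
  move=> [k _ Gk] [l _ Fl]; exists (maxn k l) => //; split.
    by apply: subsetPset (x 0 ord0) Fl; exact/ndF/leq_maxr.
  by apply: subsetPset _ Gk; exact/ndG/leq_maxl.
move=> k; have [mF Fk] := Foo k; have [mG Gk] := Goo k; split.
  rewrite -[X in measurable X]setTI; apply: measurable_unconsV => //.
  exact: measurableX.
rewrite /lebesgue_step /pushforward -comp_preimage (_ : _ \o _ = id); last first.
  by apply/funext => p; exact: consVK.
by rewrite preimage_id product_measure1E// lte_mul_pinfty// ge0_fin_numE.
Qed.

HB.instance Definition _ := Measure_isSigmaFinite.Build _ _ _ lebesgue_step
  step_sigma_finite.

End lebesgue_step.

(* n-dimensional Lebesgue measure (on Borel sets): the n-fold product of the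
   one-dimensional one, R^n.+1 being identified with R * R^n. *)
Fixpoint lebesgue_rV (R : realType) (n : nat) :
    {sigma_finite_measure set 'rV[R]_n -> \bar R} :=
  match n with
  | 0%N => \d_(0 : 'rV[R]_0)
  | n'.+1 => lebesgue_step (lebesgue_rV R n')
  end.
Arguments lebesgue_rV {R n}.

Lemma lebesgue_rV_box (R : realType) n (a b : 'rV[R]_n) :
  (forall i, a 0 i <= b 0 i) ->
  lebesgue_rV [set x : 'rV[R]_n | forall i, a 0 i <= x 0 i < b 0 i] =
  (\prod_(i < n) (b 0 i - a 0 i))%:E.
Proof.
elim: n a b => [|n IH] a b ab.
  rewrite big_ord0 /= diracE mem_set//; by case.
rewrite /= /lebesgue_step /pushforward.
pose a' : 'rV[R]_n := \row_i a 0 (lift ord0 i).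
pose b' : 'rV[R]_n := \row_i b 0 (lift ord0 i).
rewrite (_ : _ @^-1` _ = `[a 0 ord0, b 0 ord0[%classic `*`
    [set x : 'rV[R]_n | forall i, a' 0 i <= x 0 i < b' 0 i]); last first.
  apply/seteqP; split => -[r v] /=.
    move=> h; split; first by have := h ord0; rewrite mxE unlift_none in_itv.
    by move=> i; have := h (lift ord0 i); rewrite !mxE liftK.
  rewrite in_itv/= => -[h0 h] i; rewrite mxE.
  by case: unliftP => [j ->|->] //=; have := h j; rewrite !mxE.
have mB : measurable [set x : 'rV[R]_n | forall i, a' 0 i <= x 0 i < b' 0 i].
  have -> : [set x : 'rV[R]_n | forall i, a' 0 i <= x 0 i < b' 0 i] =
      \bigcap_(i in [set: 'I_n])
        (fun x : 'rV[R]_n => x 0 i) @^-1` `[a' 0 i, b' 0 i[%classic.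
    apply/seteqP; split => x /= h i; first by move=> _ /=; rewrite in_itv/=.
    by have /= := h i Logic.I; rewrite in_itv.
  apply: fin_bigcap_measurable => [|i _]; first exact: finite_finset.
  rewrite -[X in measurable X]setTI; exact: measurable_coor.
rewrite product_measure1E//=.
rewrite IH; last by move=> i; rewrite !mxE.
rewrite lebesgue_measure_itv/= lte_fin big_ord_recl /= EFinM.
under eq_bigr do rewrite !mxE.
congr (_ * _)%E; have [//|] := ltP (a 0 ord0) (b 0 ord0).
by move=> ba; rewrite (_ : a 0 ord0 = b 0 ord0) ?subrr//; apply/le_anti; rewrite ab ba.
Qed.

(* Near each boundary point A is the strict epigraph, in some unit direction e,
   of a Lipschitz function g on the hyperplane orthogonal to e. The Lipschitz
   condition of the library refers to the sup norm, which is equivalent to the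
   Euclidean one. *)
Definition lipschitz_boundary (R : realType) m (A : set 'rV[R]_m) :=
  forall x0, (closure A `\` A°) x0 ->
  exists e : 'rV[R]_m, exists g : 'rV[R]_m -> R,
    [/\ enorm e = 1,
        [lipschitz g y | y in [set y | dotv y e = 0]] &
        \forall y \near x0, A y <-> g (y - dotv y e *: e) < dotv y e].

Definition sphere (R : realType) N : set 'rV[R]_N := [set y | enorm y = 1].

Definition grid (R : realType) m (delta : R) : set 'rV[R]_m :=
  [set delta *: map_mx intr z | z in [set: 'rV[int]_m]].

Definition cell (R : realType) m (delta : R) (alpha : 'rV[R]_m) :
    set 'rV[R]_m :=
  [set x | forall i, alpha 0 i <= x 0 i < alpha 0 i + delta].

Definition Zgrid (R : realType) m (delta : R) (A : set 'rV[R]_m) :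
    set 'rV[R]_m :=
  [set alpha | grid delta alpha /\ cell delta alpha `&` A !=set0].

Definition card_set (T : choiceType) (S : set T) : nat := #|` fset_set S|.

(* corner delta x is the unique grid point alpha with x in cell delta alpha. *)
Definition corner (R : realType) m (delta : R) (x : 'rV[R]_m) : 'rV[R]_m :=
  \row_i (delta * (Num.floor (x 0 i / delta))%:~R).

(* Discrete functions Zgrid delta A -> T are represented by functions v on R^m,
   of which only the values on Zgrid delta A matter: on A, pc_ext delta v only
   depends on these. *)
Definition pc_ext (R : realType) m (T : Type) (delta : R)
    (v : 'rV[R]_m -> T) : 'rV[R]_m -> T := v \o corner delta.

Lemma pc_ext_cell (R : realType) m (T : Type) (delta : R)
    (v : 'rV[R]_m -> T) alpha x :
  0 < delta -> grid delta alpha -> cell delta alpha x ->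
  pc_ext delta v x = v alpha.
Proof.
move=> d0 [z _ <-] cx; congr v; apply/rowP => i; rewrite !mxE; congr (_ * _%:~R).
apply: floor_def; have := cx i; rewrite !mxE => /andP[h1 h2].
by rewrite ler_pdivlMr// ltr_pdivrMr// mulrC h1/= intrD mulrDl mul1r mulrC.
Qed.

Definition average (R : realType) m N (A : set 'rV[R]_m)
    (u : 'rV[R]_m -> 'rV[R]_N) : 'rV[R]_N :=
  (fine (lebesgue_rV A))^-1 *: \row_k \int[lebesgue_rV]_(x in A) u x 0 k.

Definition daverage (R : realType) m N (delta : R) (A : set 'rV[R]_m)
    (v : 'rV[R]_m -> 'rV[R]_N) : 'rV[R]_N :=
  (card_set (Zgrid delta A))%:R^-1 *: \sum_(i \in Zgrid delta A) v i.

(* u is a (Borel) representative of an element of L^oo(A, B_1^N). *)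
Definition Linfty_ball (R : realType) m N (A : set 'rV[R]_m)
    (u : 'rV[R]_m -> 'rV[R]_N) :=
  (forall k, measurable_fun A (fun x => u x 0 k)) /\
  {ae lebesgue_rV, forall x, A x -> enorm (u x) <= 1}.

(* Duality with L^1(A; R^N). *)
Definition weak_star_cvg (R : realType) m N (A : set 'rV[R]_m)
    (w : nat -> 'rV[R]_m -> 'rV[R]_N) (u : 'rV[R]_m -> 'rV[R]_N) :=
  forall phi : 'rV[R]_m -> 'rV[R]_N,
    (forall k, lebesgue_rV.-integrable A (fun x => (phi x 0 k)%:E)) ->
    (fun j => \int[lebesgue_rV]_(x in A) dotv (w j x) (phi x)) @ \oo -->
    \int[lebesgue_rV]_(x in A) dotv (u x) (phi x).

(* Main.v *)
Require Import Defs.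
From mathcomp Require Import all_boot all_order all_algebra finmap.
From mathcomp Require Import all_classical all_reals all_analysis.
From mathcomp Require Import ring lra.
Import numFieldNormedType.Exports.
Import Order.TTheory GRing.Theory Num.Theory.
Local Open Scope classical_set_scope.
Local Open Scope ring_scope.

(** Write [n] for the number of cells and [a] for the average of the limit. The
    statement splits into a geometric part, the means of the discrete functions
    tend to [a] and [n] tends to infinity, and a combinatorial part,
    [exists_modification]: [n >= 2] unit vectors with sum [s] can be given the sum
    [n a] by changing at most [2 P] of them, where [P <= C (|n a - s| + 1)] and
    [C] depends on [a] only. Together they bound [P / n] by
    [C (|a - s / n| + 1 / n)], which tends to zero.

    Combinatorial part. In dimension at least two, the sums of [q >= 2] unit
    vectors fill the ball of radius [q] ([exists_unit_sum]). Changing a set of [q]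
    vectors with sum [t] therefore achieves the sum [n a] as soon as
    [|n a - s + t| <= q], and it is enough that [|t|] be smaller than [q] by a
    fixed fraction of [q] that exceeds [|n a - s|]. Such a set exists because the
    mean stays away from the sphere: among the vectors there are many disjoint
    pairs with an angle bounded below ([exists_short_subsum]). The pairs explain
    the factor two.

    Geometric part. The sum of a discrete function times the volume of a cell is
    the integral over [A] of its extension, which converges by weak convergence,
    up to an error bounded by the volume of the part of the cells outside [A]
    ([Riemann_sum_error]). The cells shrink to the closure of [A], so that this
    volume tends to the measure of the boundary ([cvg_volume_cells]), and the
    boundary of a Lipschitz set is null: locally it is a graph, whose translates
    along the axis are disjoint ([boundary_null]). *)

(** * The Euclidean inner product *)

Section Euclid.
Context {R : realType} {N : nat}.
Implicit Types (x y z : 'rV[R]_N) (c : R).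

Lemma dotvC x y : dotv x y = dotv y x.
Proof. by apply: eq_bigr => i _; rewrite mulrC. Qed.

Lemma dotvDl x y z : dotv (x + y) z = dotv x z + dotv y z.
Proof. by rewrite -big_split; apply: eq_bigr => i _; rewrite mxE mulrDl. Qed.

Lemma dotvDr x y z : dotv z (x + y) = dotv z x + dotv z y.
Proof. by rewrite dotvC dotvDl !(dotvC z). Qed.

Lemma dotvZl c x y : dotv (c *: x) y = c * dotv x y.
Proof. by rewrite mulr_sumr; apply: eq_bigr => i _; rewrite mxE mulrA. Qed.

Lemma dotvZr c x y : dotv x (c *: y) = c * dotv x y.
Proof. by rewrite dotvC dotvZl dotvC. Qed.

Lemma dotvNl x y : dotv (- x) y = - dotv x y.
Proof. by rewrite -scaleN1r dotvZl mulN1r. Qed.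

Lemma dotvNr x y : dotv x (- y) = - dotv x y.
Proof. by rewrite dotvC dotvNl dotvC. Qed.

Lemma dot0v x : dotv 0 x = 0.
Proof. by rewrite -(scale0r 0) dotvZl mul0r. Qed.

Lemma dotv_suml I (s : seq I) (F : I -> 'rV[R]_N) y :
  dotv (\sum_(i <- s) F i) y = \sum_(i <- s) dotv (F i) y.
Proof.
elim: s => [|i s IH]; first by rewrite !big_nil dot0v.
by rewrite !big_cons dotvDl IH.
Qed.

Lemma dotv_ge0 x : 0 <= dotv x x.
Proof. by apply: sumr_ge0 => i _; rewrite -expr2 sqr_ge0. Qed.

Lemma enorm_ge0 x : 0 <= enorm x.
Proof. exact: sqrtr_ge0. Qed.

Lemma sqr_enorm x : enorm x ^+ 2 = dotv x x.
Proof. by rewrite sqr_sqrtr ?dotv_ge0. Qed.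

Lemma enorm_eq0 x : enorm x = 0 -> x = 0.
Proof.
move=> /(congr1 (fun t => t ^+ 2)); rewrite sqr_enorm expr0n/= => /eqP.
rewrite psumr_eq0 => [/allP h|i _]; last by rewrite -expr2 sqr_ge0.
apply/rowP => i; rewrite mxE; apply/eqP.
by have := h i (mem_index_enum _); rewrite /= mulf_eq0 orbb.
Qed.

Lemma enorm0 : enorm (0 : 'rV[R]_N) = 0.
Proof. by rewrite /enorm dot0v sqrtr0. Qed.

Lemma enorm_le_sqr x c : 0 <= c -> (enorm x <= c) = (dotv x x <= c ^+ 2).
Proof. by move=> c0; rewrite -sqr_enorm ler_sqr ?nnegrE ?enorm_ge0. Qed.

Lemma enormZ c x : enorm (c *: x) = `|c| * enorm x.
Proof.
by rewrite /enorm dotvZl dotvZr mulrA -expr2 sqrtrM ?sqr_ge0// sqrtr_sqr.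
Qed.

Lemma enormN x : enorm (- x) = enorm x.
Proof. by rewrite -scaleN1r enormZ normrN1 mul1r. Qed.

Lemma dotv_le_enorm x y : dotv x y <= enorm x * enorm y.
Proof.
have [->|/eqP x0] := eqVneq x 0; first by rewrite dot0v enorm0 mul0r.
have [->|/eqP y0] := eqVneq y 0; first by rewrite dotvC dot0v enorm0 mulr0.
have xp : 0 < enorm x.
  by rewrite lt0r enorm_ge0 andbT; apply/eqP => /enorm_eq0.
have yp : 0 < enorm y.
  by rewrite lt0r enorm_ge0 andbT; apply/eqP => /enorm_eq0.
have := dotv_ge0 (enorm y *: x - enorm x *: y).
rewrite dotvDl !dotvDr !dotvNl !dotvNr !dotvZl !dotvZr -!sqr_enorm (dotvC y x).
set d := dotv x y; set a := enorm x; set b := enorm y => h.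
rewrite -(ler_pM2l (mulr_gt0 xp yp)) -/a -/b; lra.
Qed.

Lemma enormD x y : enorm (x + y) <= enorm x + enorm y.
Proof.
rewrite enorm_le_sqr ?addr_ge0 ?enorm_ge0//.
rewrite dotvDl !dotvDr -!sqr_enorm (dotvC y x).
by have := dotv_le_enorm x y; set a := enorm x; set b := enorm y => ?; nra.
Qed.

Lemma enorm_sum I (s : seq I) (F : I -> 'rV[R]_N) :
  enorm (\sum_(i <- s) F i) <= \sum_(i <- s) enorm (F i).
Proof.
elim: s => [|i s IH]; first by rewrite !big_nil enorm0.
by rewrite !big_cons (le_trans (enormD _ _)) // lerD2l.
Qed.

Lemma dotv_delta x i : dotv x (delta_mx 0 i) = x 0 i.
Proof.
rewrite /dotv (bigD1 i)//= big1 ?addr0 ?mxE ?eqxx ?mulr1// => j ji.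
by rewrite mxE (negPf ji) andbF mulr0.
Qed.

Lemma normr_coord_le_enorm x i : `|x 0 i| <= enorm x.
Proof.
rewrite -sqrtr_sqr ler_wsqrtr// /dotv (bigD1 i)//= expr2 lerDl.
by apply: sumr_ge0 => j _; rewrite -expr2 sqr_ge0.
Qed.

Lemma enorm_le_sum x : enorm x <= \sum_(i < N) `|x 0 i|.
Proof.
rewrite {1}(row_sum_delta x) (le_trans (enorm_sum _ _ _))//; apply: ler_sum => i _.
by rewrite enormZ ler_piMr// /enorm dotv_delta mxE !eqxx sqrtr1.
Qed.

(** In dimension at least two, two coordinates suffice to turn by a right
    angle. *)
Lemma exists_orthogonal (x : 'rV[R]_N) : (2 <= N)%N ->
  exists2 e, enorm e = 1 & dotv x e = 0.
Proof.
move=> N2.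
have N0 : (0 < N)%N by exact: ltn_trans N2.
pose i0 : 'I_N := Ordinal N0; pose i1 : 'I_N := Ordinal N2.
suff [y y0 xy] : exists2 y, y <> 0 & dotv x y = 0.
  have yn0 : enorm y != 0 by apply/eqP => /enorm_eq0.
  exists ((enorm y)^-1 *: y); last by rewrite dotvZr xy mulr0.
  by rewrite enormZ ger0_norm ?invr_ge0 ?enorm_ge0// mulVf.
have dot2 (a b : R) : dotv x (a *: delta_mx 0 i0 + b *: delta_mx 0 i1) =
    a * x 0 i0 + b * x 0 i1.
  by rewrite dotvDr !dotvZr !dotv_delta.
have [/eqP x0|x0] := boolP (x 0 i0 == 0).
  exists (1 *: delta_mx 0 i0 + 0 *: delta_mx 0 i1); last first.
    by rewrite dot2 x0; lra.
  move/rowP/(_ i0); rewrite !mxE !eqxx/= => /eqP.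
  by rewrite mulr1 mulr0 addr0 oner_eq0.
exists (- x 0 i1 *: delta_mx 0 i0 + x 0 i0 *: delta_mx 0 i1); last first.
  by rewrite dot2; lra.
move/rowP/(_ i1); rewrite !mxE !eqxx/= => /eqP.
by rewrite mulr0 add0r mulr1 (negPf x0).
Qed.

End Euclid.

(** * Prescribing the sum of unit vectors *)

Section Prescribed_sum.
Context {R : realType} {N : nat}.
Implicit Types (w a : 'rV[R]_N).

Lemma sum_two_unit w : (2 <= N)%N -> enorm w <= 2 ->
  exists e f : 'rV[R]_N, [/\ enorm e = 1, enorm f = 1 & e + f = w].
Proof.
move=> N2 w2; have [n n1 wn] := exists_orthogonal w N2.
have ww : dotv w w <= 4.
  by rewrite -sqr_enorm; have := enorm_ge0 w => ?; nra.
pose h := Num.sqrt (1 - dotv w w / 4).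
have hh : h ^+ 2 = 1 - dotv w w / 4 by rewrite sqr_sqrtr//; lra.
have nn : dotv n n = 1 by rewrite -sqr_enorm n1 expr1n.
have unit c : c ^+ 2 = h ^+ 2 -> enorm (2^-1 *: w + c *: n) = 1.
  move=> ch; rewrite /enorm dotvDl !dotvDr !dotvZl !dotvZr (dotvC n w) wn nn.
  by rewrite -[RHS]sqrtr1; congr Num.sqrt; move: ch hh; rewrite !expr2; lra.
exists (2^-1 *: w + h *: n), (2^-1 *: w + - h *: n); split.
- exact: unit.
- by apply: unit; rewrite sqrrN.
- rewrite addrACA -!scalerDl subrr scale0r addr0.
  by rewrite (_ : 2^-1 + 2^-1 = 1) ?scale1r//; lra.
Qed.

(** Subtracting a unit vector in the direction of [w] brings the norm down by
    one as long as it exceeds one, which reduces to the case of two summands. *)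
Lemma exists_unit_sum (T : eqType) (s : seq T) w : (2 <= N)%N ->
  uniq s -> (1 < size s)%N -> enorm w <= (size s)%:R ->
  exists2 f : T -> 'rV[R]_N, forall x, enorm (f x) = 1 & \sum_(x <- s) f x = w.
Proof.
move=> N2; elim: s w => [//|x [//|y s] IH] w /andP[xs us] _ ws.
have ext e (f : T -> 'rV[R]_N) : enorm e = 1 -> (forall z, enorm (f z) = 1) ->
    e + \sum_(z <- y :: s) f z = w ->
    exists2 f : T -> 'rV[R]_N, forall x, enorm (f x) = 1 &
      \sum_(z <- [:: x, y & s]) f z = w.
  move=> e1 f1 efw; exists (fun z => if z == x then e else f z).
    by move=> z; case: ifP.
  rewrite big_cons eqxx -efw; congr (_ + _); apply: eq_big_seq => z zs.
  by case: eqP => // zx; move: xs; rewrite -zx zs.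
case: s => [|z s] in xs us ws IH ext *.
  have [e [f [e1 f1 efw]]] := sum_two_unit w N2 ws.
  by apply: (ext e (fun=> f)); rewrite ?big_seq1.
suff [e e1 we] : exists2 e, enorm e = 1 & enorm (w - e) <= (size (y :: z :: s))%:R.
  have [//|//|f f1 fw] := IH (w - e) us.
  by apply: (ext e f) => //; rewrite fw addrC subrK.
have [->|/eqP w0] := eqVneq w 0.
  have [e e1 _] := exists_orthogonal (0 : 'rV[R]_N) N2.
  by exists e => //; rewrite sub0r enormN e1 ler1n.
have wn0 : enorm w != 0 by apply/eqP => /enorm_eq0.
exists ((enorm w)^-1 *: w).
  by rewrite enormZ ger0_norm ?invr_ge0 ?enorm_ge0// mulVf.
have -> : w - (enorm w)^-1 *: w = (1 - (enorm w)^-1) *: w.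
  by rewrite scalerBl scale1r.
rewrite enormZ -{2}(ger0_norm (enorm_ge0 w)) -normrM mulrBl mul1r mulVf//.
have : 1 <= (size (y :: z :: s))%:R :> R by rewrite ler1n.
have : enorm w <= (size (y :: z :: s))%:R + 1 by rewrite natr1.
move: (size (y :: z :: s))%:R => k wk k1; rewrite ler_norml.
by have := enorm_ge0 w => ?; apply/andP; split; lra.
Qed.

(** The square of the norm of the sum is the sum of all inner products, so one
    of the latter is at most its mean value. *)
Lemma exists_small_dotv (T : eqType) (s : seq T) (v : T -> 'rV[R]_N) b :
  (0 < size s)%N ->
  enorm (\sum_(x <- s) v x) ^+ 2 <= b * (size s)%:R ^+ 2 ->
  exists x y, [/\ x \in s, y \in s & dotv (v x) (v y) <= b].
Proof.
move=> s0; apply: contraPP => nex; apply/negP; rewrite -ltNge sqr_enorm.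
rewrite dotv_suml.
have -> : b * (size s)%:R ^+ 2 = \sum_(x <- s) \sum_(y <- s) b.
  rewrite !big_const_seq !count_predT !iter_addr_0 expr2 mulrA.
  by rewrite mulr_natr mulr_natr.
have sumlt (F : T -> R) (c : T -> R) : {in s, forall x, c x < F x} ->
    \sum_(x <- s) c x < \sum_(x <- s) F x.
  case: s s0 {nex} => // z s _ h; rewrite !big_cons ltr_leD ?h ?mem_head//.
  by rewrite !big_seq; apply: ler_sum => x xs; rewrite ltW ?h// in_cons xs orbT.
apply: (sumlt) => x xs; rewrite dotvC dotv_suml; apply: (sumlt) => y ys.
by rewrite ltNge; apply/negP => yx; apply: nex; exists y, x.
Qed.

(** Pairs are extracted greedily. As long as few of them have been extracted,
    the mean of the remaining vectors stays away from the sphere, so two of them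
    make an angle bounded below, and their sum is shorter than [2] by a fixed
    amount. *)
Lemma exists_short_subsum {T : eqType} {s : seq T} {v : T -> 'rV[R]_N} {c p} :
  0 <= c < 1 -> {in s, forall x, enorm (v x) = 1} ->
  enorm (\sum_(x <- s) v x) <= c * (size s)%:R ->
  8 * p%:R <= (1 - c) * (size s)%:R ->
  exists t r, [/\ perm_eq s (t ++ r), size t = (2 * p)%N &
    enorm (\sum_(x <- t) v x) <= (2 * p)%:R * (1 - (1 - c) / 8)].
Proof.
move=> /andP[c0 c1] v1 vs; elim: p => [_|p IH ps].
  by exists [::], s; split; rewrite ?big_nil ?enorm0 ?mul0r.
have [|t [r [str tp vt]]] := IH; first by apply: le_trans ps; rewrite ler_pM2l// ler_nat.
have sr : (size s)%:R = (2 * p)%:R + (size r)%:R :> R.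
  by rewrite (perm_size str) size_cat tp natrD.
have vr1 : {in r, forall x, enorm (v x) = 1}.
  by move=> x xr; apply: v1; rewrite (perm_mem str) mem_cat xr orbT.
have p0 : 0 <= p%:R :> R by [].
have r0 : 0 <= (size r)%:R :> R by [].
have s0 : 0 <= (size s)%:R :> R by [].
move: ps; rewrite -[p.+1%:R]natr1 => ps.
have tp2 : (2 * p)%:R = 2 * p%:R :> R by rewrite natrM.
rewrite tp2 in sr vt.
have rgt0 : (0 < size r)%N.
  by rewrite -(ltr_nat R); nra.
(* (1 + c) / 2 is an intermediate bound between c and 1 for the mean of the
   remaining vectors; the bound on p keeps it valid until the end. *)
have vr : enorm (\sum_(x <- r) v x) <= (1 + c) / 2 * (size r)%:R.
  have -> : \sum_(x <- r) v x = \sum_(x <- s) v x - \sum_(x <- t) v x.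
    by rewrite (perm_big _ str) big_cat addrC addKr.
  rewrite (le_trans (enormD _ _))// enormN; rewrite sr in ps vs; nra.
have [|x [y [xr yr xy]]] := @exists_small_dotv _ r v (((1 + c) / 2) ^+ 2) rgt0.
  by rewrite -exprMn ler_sqr ?nnegrE ?enorm_ge0//; apply: mulr_ge0 => //; lra.
have xx : dotv (v x) (v x) = 1 by rewrite -sqr_enorm vr1 ?expr1n.
have yy : dotv (v y) (v y) = 1 by rewrite -sqr_enorm vr1 ?expr1n.
(* The same entry of s may occur twice in the pair given by exists_small_dotv,
   but then the inner product would be one. *)
have yx : y != x by apply/eqP => yx; move: xy; rewrite yx xx expr2; nra.
have yrx : y \in rem x r.
  have := perm_mem (perm_to_rem xr) y; rewrite yr in_cons (negPf yx)/=.
  by move=> <-.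
exists [:: x, y & t], (rem y (rem x r)); split.
- rewrite (perm_trans str)// -[[:: x, y & t]]/([:: x; y] ++ t) perm_sym -catA perm_catCA.
  rewrite perm_cat2l perm_sym/= (perm_trans (perm_to_rem xr))// perm_cons.
  exact: perm_to_rem.
- by rewrite /= tp mulnS.
- rewrite !big_cons [X in enorm X]addrA mulnS natrD tp2 [leRHS]mulrDl.
  rewrite (le_trans (enormD _ _))//; apply: lerD => //; rewrite enorm_le_sqr.
    rewrite dotvDl !dotvDr xx yy (dotvC (v y)); move: xy.
    have : 0 <= c * (1 - c) by rewrite mulr_ge0//; lra.
    by rewrite !expr2; move: (dotv _ _) => d; lra.
  by rewrite mulr_ge0//; lra.
Qed.

(** [C] bounds the number of modifications uniformly over all finite families of
    unit vectors, so that it can be fixed before the spacing of the grid. *)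
Definition modification_constant a (C : R) :=
  forall (T : eqType) (s : seq T) (v : T -> 'rV[R]_N),
  uniq s -> (1 < size s)%N -> {in s, forall x, enorm (v x) = 1} ->
  exists (v' : T -> 'rV[R]_N) (P : nat),
    [/\ {in s, forall x, enorm (v' x) = 1},
        \sum_(x <- s) v' x = (size s)%:R *: a,
        (count (fun x => v' x != v x) s <= 2 * P)%N &
        P%:R <= C * (enorm ((size s)%:R *: a - \sum_(x <- s) v x) + 1)].

(** Modifying [2 p] entries whose sum is shorter than [2 p] by a definite
    fraction leaves room to correct the total by any vector shorter than that
    fraction of [2 p]. If the family is too small or its mean too far from [a]
    for this, then its size is itself controlled by the claimed bound, and all
    entries may be modified. *)
Lemma exists_modification a : (2 <= N)%N -> enorm a < 1 ->
  exists2 C : R, 0 <= C & modification_constant a C.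
Proof.
move=> N2 a1; have a0 := enorm_ge0 a.
(* With the bound c on the mean, eta is the fraction (1 - c) / 8 gained in
   exists_short_subsum. *)
pose c := (1 + enorm a) / 2.
pose eta := (1 - enorm a) / 16; have eta0 : 0 < eta by rewrite /eta; lra.
pose K := eta^-1 / 2 + 1.
have ei0 : 0 < eta^-1 by rewrite invr_gt0.
have eei : eta * eta^-1 = 1 by rewrite divff// gt_eqF.
have K0 : 0 < K by rewrite /K; lra.
exists (K * (1 + eta^-1)); first by rewrite mulr_ge0; lra.
move=> T s v us s1 v1; set d := enorm _; have d0 : 0 <= d := enorm_ge0 _.
have n0 : 0 <= (size s)%:R :> R by [].
(* The least p >= 1 for which 2 p eta exceeds d. *)
pose p := (Num.truncn (d * (eta^-1 / 2))).+1.
have /andP[pl pu] : (Num.truncn (d * (eta^-1 / 2)))%:R <= d * (eta^-1 / 2) < p%:R.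
  by apply: truncn_itv; rewrite mulr_ge0//; lra.
have p0 : 0 <= p%:R :> R by [].
have pK : p%:R <= K * (d + 1) by rewrite -[p%:R]natr1 /K; nra.
have pd : d <= (2 * p)%:R * eta.
  rewrite natrM; have : d * (eta^-1 / 2) * eta <= p%:R * eta.
    by rewrite ler_pM2r// ltW.
  by rewrite -mulrA mulrAC (mulrC eta^-1) eei; lra.
have pC : p%:R <= K * (1 + eta^-1) * (d + 1).
  apply: (le_trans pK); rewrite ler_pM2r; last lra.
  by rewrite ler_peMr//; lra.
have [/andP[ps vs]|] := boolP ((8 * p%:R <= (1 - c) * (size s)%:R) &&
    (enorm (\sum_(x <- s) v x) <= c * (size s)%:R)).
  have c01 : 0 <= c < 1 by rewrite /c; apply/andP; split; lra.
  have [t [r [str tp vt]]] := exists_short_subsum c01 v1 vs ps.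
  have ust : uniq (t ++ r) by rewrite -(perm_uniq str).
  have /and3P[ut tr _] : [&& uniq t, ~~ has (mem t) r & uniq r] by rewrite -cat_uniq.
  have [//||||f f1 fw] := @exists_unit_sum _ t ((size s)%:R *: a - \sum_(x <- r) v x).
  - by [].
  - by rewrite tp /p mulnS.
  - have -> : (size s)%:R *: a - \sum_(x <- r) v x =
        ((size s)%:R *: a - \sum_(x <- s) v x) + \sum_(x <- t) v x.
      by rewrite (perm_big _ str) big_cat/= opprD [- _ - _]addrC addrA subrK.
    rewrite (le_trans (enormD _ _))// -/d tp.
    have : (1 - c) / 8 = eta by rewrite /c /eta; lra.
    by move: vt => /[swap] ->; lra.
  exists (fun x => if x \in t then f x else v x), p; split => //.
  + by move=> x xs; case: ifP => // _; exact: v1.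
  + have rt x : x \in r -> (x \in t) = false.
      by move=> xr; apply/negP => xt; move/hasP: tr; apply; exists x.
    rewrite (perm_big _ str) big_cat/= big_seq [X in _ + X]big_seq.
    rewrite (eq_bigr f) => [|x ->//].
    rewrite [X in _ + X](eq_bigr v) => [|x /rt ->//].
    by rewrite -!big_seq fw subrK.
  + rewrite -tp (permP str) count_cat [X in (_ + X)%N](_ : _ = 0%N) ?addn0 ?count_size//.
    apply/eqP; rewrite -leqn0 leqNgt -has_count; apply/negP => /hasP[x xr].
    case: ifP => [xt _|]; last by rewrite eqxx.
    by move/hasP: tr; apply; exists x.
have na : enorm ((size s)%:R *: a) = (size s)%:R * enorm a.
  by rewrite enormZ ger0_norm.
have [f f1 fw] : exists2 f : T -> 'rV[R]_N, forall x, enorm (f x) = 1 &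
    \sum_(x <- s) f x = (size s)%:R *: a.
  by apply: exists_unit_sum => //; rewrite na ler_piMr// ltW.
move=> big; exists f, (size s); split => //.
  by rewrite (leq_trans (count_size _ _))// leq_pmull.
suff : (size s)%:R <= K * eta^-1 * (d + 1).
  move/le_trans; apply; rewrite ler_pM2r; last lra.
  by apply: ler_wpM2l; lra.
rewrite mulrAC ler_pdivlMr//.
have [vs|vs] := lerP (enorm (\sum_(x <- s) v x)) (c * (size s)%:R).
  move: big; rewrite vs andbT -ltNge.
  have -> : 1 - c = 8 * eta by rewrite /c /eta; lra.
  by move=> big; lra.
have : enorm (\sum_(x <- s) v x) <= (size s)%:R * enorm a + d.
  rewrite -na /d -(enormN (_ *: a - _)) opprB.
  by apply: le_trans (enormD _ _); rewrite addrC subrK.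
have : c = enorm a + 8 * eta by rewrite /c /eta; lra.
by rewrite /K; nra.
Qed.

End Prescribed_sum.

(** * Grids, cells and Borel sets *)

Section Cells.
Context {R : realType} {m : nat}.
Implicit Types (d : R) (x y alpha : 'rV[R]_m) (A : set 'rV[R]_m).

Lemma measurable_box (a b : 'rV[R]_m) :
  measurable [set x : 'rV[R]_m | forall i, a 0 i <= x 0 i < b 0 i].
Proof.
have -> : [set x : 'rV[R]_m | forall i, a 0 i <= x 0 i < b 0 i] =
    \bigcap_(i in [set: 'I_m])
      (fun x : 'rV[R]_m => x 0 i) @^-1` `[a 0 i, b 0 i[%classic.
  apply/seteqP; split => x /= h i; first by move=> _ /=; rewrite in_itv/=.
  by have /= := h i Logic.I; rewrite in_itv.
apply: fin_bigcap_measurable => [|i _]; first exact: finite_finset.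
by rewrite -[X in measurable X]setTI; exact: measurable_coor.
Qed.

Lemma cellE d alpha :
  cell d alpha = [set x | forall i, alpha 0 i <= x 0 i < (alpha + const_mx d) 0 i].
Proof. by apply/seteqP; split => x /= + i => /(_ i); rewrite !mxE. Qed.

Lemma measurable_cell d alpha : measurable (cell d alpha).
Proof. by rewrite cellE; exact: measurable_box. Qed.

Lemma lebesgue_cell d alpha : 0 <= d -> lebesgue_rV (cell d alpha) = (d ^+ m)%:E.
Proof.
move=> d0; rewrite cellE lebesgue_rV_box => [|i]; last by rewrite !mxE lerDl.
congr (_%:E); under eq_bigr do rewrite !mxE addrAC subrr add0r.
by rewrite prodr_const card_ord.
Qed.

Lemma grid_corner d x : grid d (corner d x).
Proof.
exists (\row_i Num.floor (x 0 i / d)) => //.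
by apply/rowP => i; rewrite !mxE.
Qed.

Lemma cell_corner d x : 0 < d -> cell d (corner d x) x.
Proof.
move=> d0 i; rewrite mxE; have /andP[] := floor_itv (x 0 i / d).
rewrite ler_pdivlMr// ltr_pdivrMr// intrD mulrDl mul1r mulrC => -> /=.
by rewrite mulrC [X in _ < X -> _]addrC addrC.
Qed.

Lemma corner_cell d alpha x : 0 < d -> grid d alpha -> cell d alpha x ->
  corner d x = alpha.
Proof. by move=> d0 ga; exact: (@pc_ext_cell _ _ _ d id). Qed.

Lemma trivIset_cell d A : 0 < d -> trivIset (Zgrid d A) (cell d).
Proof.
move=> d0 a b [ga _] [gb _] [x [xa xb]].
by rewrite -(corner_cell _ _ _ d0 ga xa) (corner_cell _ _ _ d0 gb xb).
Qed.

Lemma sub_cells d A : 0 < d -> A `<=` \bigcup_(a in Zgrid d A) cell d a.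
Proof.
move=> d0 x Ax; exists (corner d x); last exact: cell_corner.
by split; [exact: grid_corner|exists x; split => //; exact: cell_corner].
Qed.

Lemma cell_close {d alpha x y} : cell d alpha x -> cell d alpha y ->
  forall i, `|x 0 i - y 0 i| < d.
Proof.
move=> cx cy i; have := cx i; have := cy i => /andP[? ?] /andP[? ?].
by rewrite ltr_norml; apply/andP; split; lra.
Qed.

Lemma ball_rVP (x y : 'rV[R]_m) d : 0 < d ->
  ball x d y <-> forall i, `|x 0 i - y 0 i| < d.
Proof.
move=> d0; split=> [[_ h] i|h]; first exact: h.
by split => // i j; rewrite (ord1 i); exact: h.
Qed.

(** An open set is the union of the cells it contains, over the grids of
    spacings [1 / (k + 1)]. *)
Lemma open_measurable_rV A : open A -> measurable A.
Proof.
move=> oA; pose e k : R := k.+1%:R^-1.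
pose Q k (z : 'rV[int]_m) := cell (e k) (e k *: map_mx intr z).
have -> : A = \bigcup_k \bigcup_z (if `[< Q k z `<=` A >] then Q k z else set0).
  apply/seteqP; split => [x Ax|x [k _ [z _]]]; last first.
    by case: asboolP => // h; exact: h.
  have /nbhs_ballP[r /= r0 rA] : nbhs x A by exact: open_nbhs_nbhs.
  have [k kr] : exists k, e k < r.
    exists (Num.truncn r^-1); rewrite /e invf_plt ?posrE//.
    have r1 : 0 <= r^-1 by rewrite invr_ge0 ltW.
    by have /andP[] := truncn_itv r1.
  have ek : 0 < e k by rewrite invr_gt0.
  have [z _ zx] := grid_corner (e k) x.
  exists k => //; exists z => //.
  have Qx : Q k z x by rewrite /Q zx; exact: cell_corner.
  rewrite ifT//; apply/asboolP => y Qy; apply: rA; apply/ball_rVP => // i.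
  exact: lt_trans (cell_close Qx Qy i) kr.
apply: bigcupT_measurable => k; apply: countable_bigcupT_measurable => // z.
by case: ifP => _; [exact: measurable_cell|exact: measurable0].
Qed.

Lemma closed_measurable_rV A : closed A -> measurable A.
Proof.
move=> cA; rewrite -[A]setCK; apply: measurableC; apply: open_measurable_rV.
exact: closed_openC.
Qed.

Lemma norm_coord (x : 'rV[R]_m) i : `|x 0 i| <= `|x|.
Proof.
rewrite [leRHS]/Num.norm/= mx_normrE.
by apply/bigmax_geP; right; exists (0, i).
Qed.

Lemma lebesgue_bounded_lty (M : R) A : measurable A ->
  (forall x, A x -> forall i, `|x 0 i| <= M) -> (lebesgue_rV A < +oo)%E.
Proof.
move=> mA AM.
pose b : 'rV[R]_m := const_mx (`|M| + 1).
apply: (@le_lt_trans _ _ (lebesgue_rV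
    [set x : 'rV[R]_m | forall i, (- b) 0 i <= x 0 i < b 0 i])).
  rewrite le_measure ?inE//; first exact: measurable_box.
  move=> x /AM xM i; rewrite !mxE; have := xM i; rewrite ler_norml => /andP[? ?].
  by have := ler_norm M => ?; apply/andP; split; lra.
rewrite lebesgue_rV_box ?ltry// => i; rewrite !mxE.
by have := normr_ge0 M => ?; lra.
Qed.

Lemma finite_Zgrid d A : 0 < d -> bounded_set A -> finite_set (Zgrid d A).
Proof.
move=> d0 [M [_ AM]]; have {}AM x : A x -> `|x| <= M + 1.
  by apply: (AM (M + 1)); rewrite ltrDl.
pose K := Num.truncn ((M + 1 + d) / d).
(* The coordinates of a cell that meets A, divided by d, are integers strictly
   between - K.+1 and K.+1; F encodes them by naturals below 2 * K.+1. *)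
pose F (f : {ffun 'I_m -> 'I_(K.+1 + K.+1)}) : 'rV[R]_m :=
  d *: \row_i ((f i)%:R - K.+1%:R).
apply: (@sub_finite_set _ _ [set F f | f in setT]).
  move=> alpha [[z _ <-] [x [xa /AM xM]]].
  have zK i : - K.+1%:R < (z 0 i)%:~R :> R /\ (z 0 i)%:~R < K.+1%:R :> R.
    have := xa i; rewrite !mxE => /andP[h1 h2].
    have : `|x 0 i| <= M + 1 := le_trans (norm_coord _ _) xM.
    rewrite ler_norml => /andP[h3 h4].
    have M0 : 0 <= (M + 1 + d) / d by rewrite divr_ge0 ?(ltW d0)//; lra.
    have /andP[_] := truncn_itv M0; rewrite -/K ltr_pdivrMr// => h5.
    split; first by rewrite -(ltr_pM2l d0); lra.
    by rewrite -(ltr_pM2l d0); lra.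
  have zp i : (0 <= z 0 i + K.+1%:Z)%R && (z 0 i + K.+1%:Z < (K.+1 + K.+1)%:Z)%R.
    have [h1 h2] := zK i; rewrite -(ler_int R) -(ltr_int R) intrD -!pmulrn natrD.
    by rewrite mulr0n; apply/andP; split; lra.
  have zlt i : (absz (z 0 i + K.+1%:Z)%R < K.+1 + K.+1)%N.
    by have /andP[h1 h2] := zp i; rewrite -ltz_nat gez0_abs.
  exists [ffun i => Ordinal (zlt i)] => //; rewrite /F; congr (_ *: _).
  apply/rowP => i; have /andP[zi _] := zp i.
  rewrite !mxE ffunE /= pmulrn gez0_abs//.
  by rewrite intrD -pmulrn addrK.
by apply: finite_image; exact: finite_finset.
Qed.

End Cells.

(** * Translation invariance *)

Section Translation.
Context {R : realType}.

Lemma lebesgue_measure_translate (c : R) (A : set (measurableTypeR R)) :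
  measurable A ->
  lebesgue_measure ((fun x : R => x + c) @^-1` A) = lebesgue_measure A.
Proof.
move=> mA; apply/esym.
have mf : measurable_fun setT
    ((fun x => x + c) : measurableTypeR R -> measurableTypeR R).
  by apply: measurable_realfun.measurable_funD => //; exact: measurable_cst.
pose nu := measure_function_pushforward__canonical__measure_function_Measure
  (@lebesgue_measure R) mf.
rewrite (_ : lebesgue_measure (_ @^-1` A) = nu A)//.
apply: lebesgue_measure_unique mA => _ /ocitvP[->|[[a b]/= ab ->]].
  by rewrite !measure0.
rewrite /nu/= /pushforward.
have -> : (fun x => x + c) @^-1` `]a, b]%classic = `](a - c), (b - c)]%classic.
  by apply/seteqP; split => x /=; rewrite !in_itv/= ltrBlDr lerBrDr.
rewrite !lebesgue_measure_itv/= !lte_fin ltrD2r ab.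
by rewrite -!EFinB opprB addrA subrK.
Qed.

Lemma measurable_translate n (t : 'rV[R]_n) :
  measurable_fun setT (fun x : 'rV[R]_n => x + t).
Proof.
apply/measurable_fun_rVP => i; under eq_fun do rewrite mxE.
by apply: measurable_realfun.measurable_funD; [exact: measurable_coor|exact: measurable_cst].
Qed.

Lemma measurable_preimage_translate n (t : 'rV[R]_n) A : measurable A ->
  measurable ((fun x => x + t) @^-1` A).
Proof.
by move=> mA; rewrite -[X in measurable X]setTI; exact: measurable_translate.
Qed.

Lemma lebesgue_rV_translate n (t : 'rV[R]_n) A : measurable A ->
  lebesgue_rV ((fun x => x + t) @^-1` A) = lebesgue_rV A.
Proof.
elim: n t A => [|n IH] t A mA.
  congr (lebesgue_rV _); apply/seteqP.
  by split => x /=; rewrite (thinmx0 (x + t)) (thinmx0 x).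
rewrite /= /lebesgue_step /pushforward.
pose R1 := measurableTypeR R.
pose t' : 'rV[R]_n := \row_i t 0 (lift ord0 i).
pose T (p : R1 * 'rV[R]_n) : R1 * 'rV[R]_n := (p.1 + t 0 ord0, p.2 + t').
have mT : measurable_fun setT T.
  apply/measurable_fun_pairP; split => /=.
    by apply: measurable_realfun.measurable_funD; [exact: measurable_fst|exact: measurable_cst].
  exact: measurableT_comp (measurable_translate n t') measurable_snd.
have -> : @consV R n @^-1` ((fun x => x + t) @^-1` A) = T @^-1` (@consV R n @^-1` A).
  suff h p : consV p + t = consV (T p) by apply/seteqP; split => p /=; rewrite h.
  by apply/rowP => i; rewrite !mxE; case: unliftP => [j ->|->]; rewrite /= ?mxE.
have mB : measurable (@consV R n @^-1` A).
  by rewrite -[X in measurable X]setTI; exact: (@measurable_consV R n).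
apply/esym.
apply: (@product_measure_unique _ _ _ _ R (@lebesgue_measure R) (lebesgue_rV (n := n))
  (measure_function_pushforward__canonical__measure_function_Measure
     (product_measure1 (@lebesgue_measure R) (lebesgue_rV (n := n))) mT)) mB => X Y mX mY.
rewrite /= /pushforward.
have -> : T @^-1` (X `*` Y) =
   ((fun x : R => x + t 0 ord0) @^-1` X) `*` ((fun x => x + t') @^-1` Y) by [].
rewrite product_measure1E//.
- by congr (_ * _)%E; [exact: lebesgue_measure_translate|exact: IH].
- rewrite -[X in measurable X]setTI.
  have mf : measurable_fun setT ((fun x => x + t 0 ord0) : R1 -> R1).
    by apply: measurable_realfun.measurable_funD => //; exact: measurable_cst.
  exact: mf.
- exact: measurable_preimage_translate.
Qed.

(** Infinitely many disjoint translates of a set of positive measure do not fit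
    into a bounded set. *)
Lemma lebesgue_null_translates n (e : 'rV[R]_n) (M : R) (S : set 'rV[R]_n) :
  measurable S -> (forall x, S x -> `|x| <= M) ->
  (forall x t, 0 < t -> t <= 1 -> S x -> ~ S (x + t *: e)) ->
  lebesgue_rV S = 0%E.
Proof.
move=> mS SM dS.
(* Shifts within ]0, 1] whose differences stay there, as dS asks. *)
pose t k : R := k.+1%:R^-1.
have t0 k : 0 < t k by rewrite invr_gt0.
have t1 k : t k <= 1 by rewrite invf_le1// ler1n.
pose F k := (fun x => x + t k *: e) @^-1` S.
have mF k : measurable (F k) by exact: measurable_preimage_translate.
have muF k : lebesgue_rV (F k) = lebesgue_rV S by exact: lebesgue_rV_translate.
have tF : trivIset setT F.
  apply: ltn_trivIset => j i ij; apply/seteqP; split => // x [Fi Fj].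
  have tij : t j < t i.
    by rewrite /t ltf_pV2 ?posrE// ltr_nat.
  apply: (dS (x + t j *: e) (t i - t j)); rewrite ?subr_gt0//.
    by have := t0 j; have := t1 i; lra.
  by rewrite -addrA -scalerDl addrCA subrr addr0.
have UM : (lebesgue_rV (\bigcup_k F k) < +oo)%E.
  apply: (@lebesgue_bounded_lty _ _ (M + `|e|)); first exact: bigcupT_measurable.
  move=> x [k _ Fx] i; apply: le_trans (norm_coord _ _) _.
  rewrite -[x](addrK (t k *: e)) (le_trans (ler_normB _ _))// lerD ?SM//.
  by rewrite normrZ ler_piMl// gtr0_norm.
have nU k : ((lebesgue_rV S) *+ k <= lebesgue_rV (\bigcup_k F k))%E.
  have -> : ((lebesgue_rV S) *+ k = lebesgue_rV (\big[setU/set0]_(i < k) F i))%E.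
    rewrite measure_bigsetU// (eq_bigr (fun=> lebesgue_rV S)) => [|i _]; last exact: muF.
    by rewrite sumr_const card_ord.
  rewrite le_measure ?inE//; [exact: bigsetU_measurable|exact: bigcupT_measurable|].
  exact: bigsetU_bigcup.
have U0 : (0 <= lebesgue_rV (\bigcup_k F k))%E by exact: measure_ge0.
have S0 : (0 <= lebesgue_rV S)%E by exact: measure_ge0.
move: UM nU U0.
move: (lebesgue_rV (\bigcup_k F k)) => [b _ nb b0| |]//.
move: nb S0 => {muF}.
move: (lebesgue_rV S) => [s nb s0|/(_ 1%N) h|//]; last first.
  by have : (+oo <= b%:E)%E := h; rewrite leye_eq.
rewrite !lee_fin in b0 s0; congr (_%:E); apply/eqP; rewrite -[_ == _]negbK; apply/negP => sn0.
have {sn0 s0} s0 : 0 < s by rewrite lt0r sn0.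
have := nb (Num.truncn (b / s)).+1; rewrite -EFin_natmul lee_fin -mulr_natl.
rewrite -ler_pdivlMr// leNgt => /negP; apply.
by have /andP[] := truncn_itv (divr_ge0 b0 (ltW s0)).
Qed.

End Translation.

(** * The boundary of a Lipschitz set *)

Section Boundary.
Context {R : realType} {m : nat}.
Implicit Types (A : set 'rV[R]_m) (x y e : 'rV[R]_m).

Lemma normr_dotv_le e : exists2 K : R, 0 <= K & forall x, `|dotv x e| <= K * `|x|.
Proof.
exists (\sum_(i < m) `|e 0 i|) => [|x]; first by apply: sumr_ge0.
rewrite mulr_suml (le_trans (ler_norm_sum _ _ _))//; apply: ler_sum => i _.
by rewrite normrM mulrC ler_wpM2l// norm_coord.
Qed.

Lemma closure_norm_le A (M : R) : (forall x, A x -> `|x| <= M) ->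
  forall x, closure A x -> `|x| <= M + 1.
Proof.
move=> AM x /(_ (ball x 1) (nbhsx_ballx _ _ ltr01))[a [/AM aM]].
rewrite -ball_normE/= => xa; rewrite -[x](subrK a) addrC.
by rewrite (le_trans (ler_normD _ _))// lerD// ltW.
Qed.

(** Near a boundary point, moving upwards along the axis of the epigraph leads
    from the graph into [A], so the translates of the boundary in that direction
    are disjoint. Continuity of the graph function places the closure of [A]
    above the graph. *)
Lemma boundary_locally_null A : open A -> lipschitz_boundary A ->
  forall x0, (closure A `\` A) x0 -> exists2 r : R, 0 < r &
    lebesgue_rV ((closure A `\` A) `&` ball x0 r) = 0%E.
Proof.
move=> oA lA x0 Gx0.
have [|e [g [e1 lg]]] := lA x0; first by move/interior_id: oA => ->.
move=> /nbhs_ballP[r /= r0 rA]; exists r => //.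
have [k k0 gk] := pinfty_ex_gt0 lg.
have [K K0 eK] := normr_dotv_le e.
pose p y : 'rV[R]_m := y - dotv y e *: e.
have ee : dotv e e = 1 by rewrite -sqr_enorm e1 expr1n.
have pe y : dotv (p y) e = 0 by rewrite dotvDl dotvNl dotvZl ee mulr1 subrr.
have gp y z : `|g (p y) - g (p z)| <= k * `|p y - p z|.
  by apply: (gk (p y, p z)); split; exact: pe.
apply: (@lebesgue_null_translates _ _ e (`|x0| + r)).
- apply: measurableI; last by apply: open_measurable_rV; exact: ball_open.
  apply: measurableD; last exact: open_measurable_rV.
  by apply: closed_measurable_rV; exact: closed_closure.
- move=> x [_]; rewrite -ball_normE/= => xr.
  rewrite -[x](subrK x0) addrC (le_trans (ler_normD _ _))// lerD2l distrC.
  exact: ltW.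
move=> x t t0 _ [[clx _] xr] [[_ nA] xtr].
have gt : dotv x e + t <= g (p x).
  have pxt : p (x + t *: e) = p x.
    rewrite /p dotvDl dotvZl ee mulr1 scalerDl opprD addrACA.
    by rewrite subrr addr0.
  have := rA _ xtr; rewrite /= -/(p _) pxt dotvDl dotvZl ee mulr1 => -[_ h].
  by rewrite leNgt; apply/negP => /h.
(* Points of A above the graph and tending to x would contradict gt; L is a
   Lipschitz constant of dotv^~ e - g \o p. *)
pose L := K + k * (1 + K * `|e|) + 1.
have L0 : 0 < L.
  rewrite /L ltr_wpDl// addr_ge0// mulr_ge0 ?(ltW k0)// addr_ge0// mulr_ge0//.
have [|a [Aa [ar]]] := clx (ball x0 r `&` ball x (t / L)).
  apply: filterI; first by apply: open_nbhs_nbhs; split => //; exact: ball_open.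
  by apply: nbhsx_ballx; rewrite divr_gt0.
rewrite -ball_normE/= => xa.
have /rA/=[/(_ Aa) ga _] := ar; rewrite -/(p _) in ga.
have hd : dotv a e - dotv x e <= K * `|x - a|.
  rewrite -dotvNl -dotvDl (le_trans (ler_norm _))// distrC; exact: eK.
have hp : `|p x - p a| <= (1 + K * `|e|) * `|x - a|.
  have -> : p x - p a = (x - a) - dotv (x - a) e *: e.
    by rewrite /p dotvDl dotvNl scalerDl scaleNr !opprD !opprK addrACA.
  rewrite (le_trans (ler_normB _ _))// mulrDl mul1r lerD2l normrZ.
  by rewrite mulrAC ler_wpM2r.
have hg : g (p x) - g (p a) <= k * ((1 + K * `|e|) * `|x - a|).
  rewrite (le_trans (ler_norm _))// (le_trans (gp _ _))//.
  by rewrite ler_pM2l.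
have : `|x - a| * L < t by rewrite -ltr_pdivlMr.
have := normr_ge0 (x - a).
by move: hg hd; rewrite /L; lra.
Qed.

Lemma boundary_null A : open A -> bounded_set A -> lipschitz_boundary A ->
  lebesgue_rV (closure A `\` A) = 0%E.
Proof.
move=> oA [M [_ AM]] lA.
have clA x : closure A x -> `|x| <= M + 1 + 1.
  by apply: closure_norm_le => y; apply: AM; rewrite ltrDl.
have cG : closed (closure A `\` A).
  by apply: closedI; [exact: closed_closure|exact: open_closedC].
have : compact (closure A `\` A).
  apply: bounded_closed_compact => //; exists (M + 1 + 1); split.
    exact: num_real.
  by move=> M' MM' x [/clA xM _]; exact: le_trans xM (ltW MM').
(* The cover is indexed by all balls in which the boundary is null. *)
pose D := [set q : 'rV[R]_m * R |
  lebesgue_rV ((closure A `\` A) `&` ball q.1 q.2) = 0%E].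
rewrite compact_cover => /(_ _ D (fun q => ball q.1 q.2)) [|x Gx|D' D'D cov].
- by move=> q _; exact: ball_open.
- have [r r0 xr] := boundary_locally_null A oA lA x Gx.
  by exists (x, r) => //; exact: ballxx.
have mG : measurable (closure A `\` A) by exact: closed_measurable_rV.
apply/eqP; rewrite eq_le measure_ge0 andbT.
apply: le_trans (content_sub_fsum _ (finite_fset D')
  (A_ := fun q => (closure A `\` A) `&` ball q.1 q.2) _ mG _) _.
- move=> q _; apply: measurableI => //.
  by apply: open_measurable_rV; exact: ball_open.
- by move=> x Gx; have [q qD' xq] := cov x Gx; exists q.
by rewrite fsbig1// => q /D'D; rewrite inE.
Qed.

End Boundary.

(** * The total volume of the cells *)

Section Volume.
Context {R : realType} {m : nat} {A : set 'rV[R]_m}.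

Definition cells (d : R) := \bigcup_(a in Zgrid d A) cell d a.

Lemma measurable_cells d : 0 < d -> bounded_set A -> measurable (cells d).
Proof.
move=> d0 bA; apply: fin_bigcup_measurable => [|a _]; first exact: finite_Zgrid.
exact: measurable_cell.
Qed.

Lemma lebesgue_cells d : 0 < d -> bounded_set A ->
  lebesgue_rV (cells d) = ((card_set (Zgrid d A))%:R * d ^+ m)%:E.
Proof.
move=> d0 bA; have fZ := finite_Zgrid d A d0 bA.
rewrite measure_fin_bigcup//; [|exact: trivIset_cell|by move=> *; exact: measurable_cell].
rewrite (eq_fsbigr (fun=> (d ^+ m)%:E)) => [|a _]; last exact: lebesgue_cell (ltW d0).
rewrite fsbig_finite//= sumEFin big_const_seq count_predT iter_addr_0.
by rewrite mulr_natl.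
Qed.

(** The cells covering [A] shrink to a subset of the closure of [A], which has
    the measure of [A]. *)
Lemma cvg_volume_cells (delta : nat -> R) : open A -> bounded_set A ->
  lipschitz_boundary A -> (forall j, 0 < delta j) ->
  delta @ \oo --> (0 : R) ->
  (fun j => (card_set (Zgrid (delta j) A))%:R * delta j ^+ m) @ \oo -->
    fine (lebesgue_rV A).
Proof.
move=> oA bA lA d0 dcvg; have mA := open_measurable_rV _ oA.
have [D dD] : exists D, forall j, delta j <= D.
  have /cvg_seq_bounded[D [_ h]] : cvgn delta by apply/cvg_ex; exists 0.
  by exists (D + 1) => j; rewrite (le_trans (ler_norm _))// h// ltrDl.
have [M AM] : exists M, forall x, A x -> `|x| <= M.
  by move: bA => [M [_ h]]; exists (M + 1); apply: h; rewrite ltrDl.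
(* The sets cells (delta j) need not decrease with j; the F k do. *)
pose F k := \bigcup_(j in [set j | (k <= j)%N]) cells (delta j).
have mF k : measurable (F k).
  by apply: bigcup_measurable => j _; exact: measurable_cells.
have cellsA j x : cells (delta j) x -> exists2 a, A a & forall i, `|x 0 i - a 0 i| < delta j.
  by move=> [al [_ [a [aal Aa]]] xal]; exists a => //; exact: cell_close.
have Foo k : (lebesgue_rV (F k) < +oo)%E.
  apply: (@lebesgue_bounded_lty _ _ (M + D)) => // x [j _ /cellsA[a Aa xa]] i.
  rewrite -[x 0 i](subrK (a 0 i)) addrC (le_trans (ler_normD _ _))//.
  rewrite lerD//; first exact: le_trans (norm_coord _ _) (AM _ Aa).
  exact: ltW (lt_le_trans (xa i) (dD j)).
have AF k : A `<=` F k.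
  by move=> x Ax; exists k => //=; exact: sub_cells.
have FclA : \bigcap_k F k `<=` closure A.
  move=> x Fx B /nbhs_ballP[r /= r0 rB].
  have /cvgrPdist_lt/(_ r r0)[k _ kr] := dcvg.
  have [j /= kj /cellsA[a Aa xa]] := Fx k Logic.I.
  exists a; split => //; apply: rB; apply/ball_rVP => // i.
  rewrite (lt_trans (xa i))//; have := kr j kj.
  by rewrite sub0r normrN gtr0_norm.
have mcapF : measurable (\bigcap_k F k) by exact: bigcapT_measurable.
have mclA : measurable (closure A) by apply: closed_measurable_rV; exact: closed_closure.
have capF : lebesgue_rV (\bigcap_k F k) = lebesgue_rV A.
  apply/eqP; rewrite eq_le; apply/andP; split; last first.
    by rewrite le_measure ?inE// => x Ax k _; exact: AF.
  apply: (@le_trans _ _ (lebesgue_rV (closure A))); first by rewrite le_measure ?inE.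
  rewrite (measureDI lebesgue_rV mclA mA).
  rewrite [X in (X + _)%E](_ : _ = 0%E) ?add0e; last exact: boundary_null.
  by rewrite le_measure ?inE//; exact: measurableI.
have Aoo : lebesgue_rV A \is a fin_num.
  rewrite ge0_fin_numE ?measure_ge0//.
  by apply: le_lt_trans (Foo 0%N); rewrite le_measure ?inE//.
have cF : (fun k => fine (lebesgue_rV (F k))) @ \oo --> fine (lebesgue_rV A).
  apply: fine_cvg; rewrite fineK// -capF.
  apply: nonincreasing_cvg_mu => [|//|//|i j ij]; first exact: Foo.
  apply/subsetPset.
  by apply: bigcup_subset => k /= jk; exact: leq_trans jk.
apply: squeeze_cvgr (cvg_cst (fine (lebesgue_rV A))) cF.
near=> j; have ccell : lebesgue_rV (cells (delta j)) \is a fin_num.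
  by rewrite lebesgue_cells.
have -> : (card_set (Zgrid (delta j) A))%:R * delta j ^+ m =
    fine (lebesgue_rV (cells (delta j))) by rewrite lebesgue_cells.
apply/andP; split; apply: fine_le => //.
- by rewrite le_measure ?inE//; [exact: measurable_cells|exact: sub_cells].
- by rewrite ge0_fin_numE ?measure_ge0.
- rewrite le_measure ?inE//; first exact: measurable_cells.
  by move=> x xj; exists j => /=.
Unshelve. all: by end_near.
Qed.

End Volume.

(** * Convergence of the discrete averages *)

Section Averages.
Context {R : realType} {m : nat} {A : set 'rV[R]_m}.
Hypotheses (oA : open A) (bA : bounded_set A).

Let mA : measurable A. Proof. exact: open_measurable_rV. Qed.

Lemma lebesgue_open_lty : (lebesgue_rV A < +oo)%E.
Proof.
move: bA => [M [_ AM]]; apply: (@lebesgue_bounded_lty _ _ (M + 1)) => // x Ax i.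
by apply: le_trans (norm_coord _ _) _; apply: AM => //; rewrite ltrDl.
Qed.

Lemma lebesgue_open_gt0 : A !=set0 -> 0 < fine (lebesgue_rV A).
Proof.
move=> [x Ax].
have /nbhs_ballP[r /= r0 rA] : nbhs x A by exact: open_nbhs_nbhs.
rewrite fine_gt0// lebesgue_open_lty andbT.
apply: (@lt_le_trans _ _ (lebesgue_rV (cell r (corner r x)))).
  by rewrite lebesgue_cell ?ltW// lte_fin exprn_gt0.
rewrite le_measure ?inE//; first exact: measurable_cell.
move=> y xy; apply/rA/ball_rVP => // i.
exact: cell_close (cell_corner _ _ r0) xy i.
Qed.

Lemma Rintegral_pc_ext d (v : 'rV[R]_m -> R) : 0 < d ->
  \int[lebesgue_rV]_(x in A) pc_ext d v x =
  \sum_(a <- fset_set (Zgrid d A)) v a * fine (lebesgue_rV (cell d a `&` A)).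
Proof.
move=> d0; have fZ := finite_Zgrid d A d0 bA.
rewrite /Rintegral.
transitivity (fine (\int[lebesgue_rV]_(x in A)
    (\sum_(a <- fset_set (Zgrid d A)) (v a)%:E * (\1_(cell d a) x)%:E)))%E.
  congr fine; apply: eq_integral => x /set_mem Ax.
  have Zx : Zgrid d A (corner d x).
    split; first exact: grid_corner.
    by exists x; split => //; exact: cell_corner.
  rewrite (bigD1_seq (corner d x)) ?fset_uniq//=; last by rewrite in_fset_set ?inE.
  rewrite big_seq_cond big1 => [|a /andP[]].
    by rewrite adde0 indicE mem_set ?mule1//; exact: cell_corner.
  rewrite in_fset_set// inE => -[ga _] ax.
  rewrite indicE memNset ?mule0// => xa.
  by move: ax; rewrite (corner_cell d a x d0 ga xa) eqxx.
have mC (a : 'rV[R]_m) : measurable (cell d a) by exact: measurable_cell.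
have i1 a : lebesgue_rV.-integrable A (fun x => (\1_(cell d a) x)%:E).
  apply: (measurable_bounded_integrable mA lebesgue_open_lty).
    by apply: measurable_realfun.measurable_indic; exact: measurable_cell.
  exists 1; split; first exact: num_real.
  move=> M M1 x _; rewrite /= indicE (le_trans _ (ltW M1))//.
  by rewrite ger0_norm// lern1 leq_b1.
have iv a : lebesgue_rV.-integrable A (fun x => (v a)%:E * (\1_(cell d a) x)%:E)%E.
  by apply: integrableZl.

rewrite integral_sum//.
have fin a : lebesgue_rV (cell d a `&` A) \is a fin_num.
  rewrite ge0_fin_numE //; apply: le_lt_trans lebesgue_open_lty.
  by rewrite le_measure ?inE//; exact: measurableI.
rewrite (eq_bigr (fun a => (v a * fine (lebesgue_rV (cell d a `&` A)))%:E)) => [|a _].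
  by rewrite sumEFin.
rewrite EFinM fineK//.
by rewrite integralZl// integral_indic.
Qed.

(** The cells that stick out of [A] are responsible for the difference between
    a Riemann sum and the integral of the extension over [A]. *)
Lemma Riemann_sum_error d (v : 'rV[R]_m -> R) : 0 < d ->
  (forall a, Zgrid d A a -> `|v a| <= 1) ->
  `|d ^+ m * (\sum_(a <- fset_set (Zgrid d A)) v a) -
    \int[lebesgue_rV]_(x in A) pc_ext d v x| <=
  (card_set (Zgrid d A))%:R * d ^+ m - fine (lebesgue_rV A).
Proof.
move=> d0 v1; have fZ := finite_Zgrid d A d0 bA.
pose w a : R := fine (lebesgue_rV (cell d a `&` A)).
have w1 a : w a <= d ^+ m.
  have mc : lebesgue_rV (cell d a) = (d ^+ m)%:E := lebesgue_cell _ _ (ltW d0).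
  have : (lebesgue_rV (cell d a `&` A) <= (d ^+ m)%:E)%E.
    rewrite -mc le_measure ?inE//; last exact: measurable_cell.
    by apply: measurableI => //; exact: measurable_cell.
  have w0 : (0 <= lebesgue_rV (cell d a `&` A))%E by exact: measure_ge0.
  by rewrite /w; case: (lebesgue_rV _) w0 => [x| |]//=; rewrite lee_fin.
have <- : \int[lebesgue_rV]_(x in A) pc_ext d (fun=> 1) x = fine (lebesgue_rV A).
  by rewrite /pc_ext/= Rintegral_cst// mul1r.
rewrite !Rintegral_pc_ext//.
have -> : (card_set (Zgrid d A))%:R * d ^+ m =
    \sum_(a <- fset_set (Zgrid d A)) d ^+ m.
  by rewrite big_const_seq count_predT iter_addr_0 mulr_natl.
rewrite mulr_sumr -!sumrB (le_trans (ler_norm_sum _ _ _))// big_seq [leRHS]big_seq.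
apply: ler_sum => a; rewrite in_fset_set// inE => /v1 va.
rewrite mul1r mulrC -mulrBr normrM -[X in _ <= X]mul1r ler_pM//.
by rewrite ger0_norm// subr_ge0; exact: w1.
Qed.

End Averages.

Section Discrete_average.
Context {R : realType} {m N : nat} {A : set 'rV[R]_m} {delta : nat -> R}
  {u_ : nat -> 'rV[R]_m -> 'rV[R]_N} {u : 'rV[R]_m -> 'rV[R]_N}.
Hypotheses (A0 : A !=set0) (oA : open A) (bA : bounded_set A)
  (lA : lipschitz_boundary A) (delta_gt0 : forall j, 0 < delta j)
  (delta_cvg : delta @ \oo --> (0 : R)).

Let n j : R := (card_set (Zgrid (delta j) A))%:R.

Let volE := cvg_volume_cells delta oA bA lA delta_gt0 delta_cvg.

Lemma inv_card_Zgrid_cvg : (0 < m)%N -> (fun j => (n j)^-1) @ \oo --> (0 : R).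
Proof.
move=> m0; have V0 := lebesgue_open_gt0 oA bA A0.
have -> : (fun j => (n j)^-1) = (fun j => delta j ^+ m * (n j * delta j ^+ m)^-1).
  apply/funext => j; rewrite invfM mulrCA mulfV ?mulr1//.
  by rewrite gt_eqF// exprn_gt0.
rewrite -[X in _ --> X](mul0r (fine (lebesgue_rV A))^-1).
apply: cvgM; last by apply: cvgV => //; rewrite gt_eqF.
have -> : 0 = (0 : R) ^+ m by rewrite expr0n gtn_eqF.
elim: (m) => [|k IH]; first by under eq_fun do rewrite expr0; exact: cvg_cst.
by under eq_fun do rewrite exprS; rewrite exprS; exact: cvgM.
Qed.

(** Testing the weak convergence against the constant fields of the canonical
    basis gives the convergence of the integrals of the extensions; dividing by
    the total volume of the cells instead of that of [A] makes no difference in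
    the limit. *)
Lemma discrete_mean_cvg :
  (forall j a, Zgrid (delta j) A a -> sphere (u_ j a)) ->
  weak_star_cvg A (fun j => pc_ext (delta j) (u_ j)) u ->
  forall k, (fun j => (n j)^-1 * (\sum_(a <- fset_set (Zgrid (delta j) A)) u_ j a 0 k))
     @ \oo --> average A u 0 k.
Proof.
move=> us uw k; have V0 := lebesgue_open_gt0 oA bA A0.
have mA := open_measurable_rV A oA.
pose I j := \int[lebesgue_rV]_(x in A) pc_ext (delta j) (fun a => u_ j a 0 k) x.
have Icvg : I @ \oo --> \int[lebesgue_rV]_(x in A) u x 0 k.
  have /= := uw (fun=> delta_mx 0 k) _.
  under eq_fun do under eq_Rintegral do rewrite dotv_delta.
  under eq_Rintegral do rewrite dotv_delta.
  apply => l; apply: (measurable_bounded_integrable mA (lebesgue_open_lty oA bA)).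
    exact: measurable_cst.
  exists 1; split; first exact: num_real.
  move=> M M1 x _; rewrite /= mxE (le_trans _ (ltW M1))//.
  by rewrite ger0_norm// lern1 leq_b1.
pose S j := delta j ^+ m * (\sum_(a <- fset_set (Zgrid (delta j) A)) u_ j a 0 k).
have SI j : `|S j - I j| <= n j * delta j ^+ m - fine (lebesgue_rV A).
  apply: Riemann_sum_error => // a /us <-; exact: normr_coord_le_enorm.
have Ecvg : (fun j => n j * delta j ^+ m - fine (lebesgue_rV A)) @ \oo --> (0 : R).
  rewrite -[X in _ --> X](subrr (fine (lebesgue_rV A))).
  by apply: cvgB => //; exact: cvg_cst.
have Scvg : S @ \oo --> \int[lebesgue_rV]_(x in A) u x 0 k.
  have -> : S = (fun j => (S j - I j) + I j) by apply/funext => j; rewrite subrK.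
  rewrite -[X in _ --> X]add0r; apply: cvgD => //.
  apply/norm_cvg0P; apply: squeeze_cvgr (cvg_cst 0) Ecvg.
  by near=> j; rewrite /= normr_ge0 SI.
have -> : (fun j => (n j)^-1 * (\sum_(a <- fset_set (Zgrid (delta j) A)) u_ j a 0 k))
    = (fun j => (n j * delta j ^+ m)^-1 * S j).
  apply/funext => j; rewrite invfM /S -!mulrA; congr (_ * _).
  by rewrite mulrA mulVf ?mul1r// gt_eqF// exprn_gt0.
rewrite /average !mxE; apply: cvgM => //.
by apply: cvgV => //; rewrite gt_eqF.
Unshelve. all: by end_near.
Qed.

End Discrete_average.

(** * Modification of discrete functions *)

(** At most one cell leaves no choice for the mean, whose value is then not
    prescribed; the discrete function is kept in this case. *)
Lemma exists_modification_Zgrid {R : realType} {m N : nat} (A : set 'rV[R]_m)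
    (d : R) (v : 'rV[R]_m -> 'rV[R]_N) (a : 'rV[R]_N) (C : R) :
  0 < d -> bounded_set A -> 0 <= C -> modification_constant a C ->
  (forall al, Zgrid d A al -> sphere (v al)) ->
  exists vP : ('rV[R]_m -> 'rV[R]_N) * nat,
    [/\ forall al, Zgrid d A al -> sphere (vP.1 al),
        (1 < card_set (Zgrid d A))%N -> daverage d A vP.1 = a,
        (card_set [set al | Zgrid d A al /\ vP.1 al <> v al] <= 2 * vP.2)%N &
        vP.2%:R / (card_set (Zgrid d A))%:R <=
          C * (\sum_(k < N) `|a 0 k - (card_set (Zgrid d A))%:R^-1 *
                 (\sum_(al <- fset_set (Zgrid d A)) v al 0 k)| +
               (card_set (Zgrid d A))%:R^-1)].
Proof.
move=> d0 bA C0 mod v1; have fZ := finite_Zgrid d A d0 bA.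
set n := card_set (Zgrid d A).
have rhs0 (s : R) : 0 <= s -> 0 <= C * (s + n%:R^-1).
  by move=> s0; rewrite mulr_ge0// addr_ge0// invr_ge0.
have [n1|n1] := leqP n 1.
  exists (v, 0%N); split => //=.
    rewrite /card_set (_ : [set al | _] = set0) ?fset_set0 ?cardfs0//.
    by apply/seteqP; split => // al [].
  by rewrite mul0r rhs0// sumr_ge0.
have [|v' [P [v'1 sumv' cv' PC]]] := mod _ (enum_fset (fset_set (Zgrid d A))) v (fset_uniq _) n1.
  by move=> al; rewrite in_fset_set// inE => /v1.
have n0 : 0 < n%:R :> R by rewrite ltr0n ltnW.
exists (v', P); split => /=.
- by move=> al Zal; apply: v'1; rewrite in_fset_set// inE.
- by rewrite /daverage fsbig_finite//= sumv' scalerA mulVf ?scale1r ?gt_eqF.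
- apply: leq_trans cv'; rewrite -size_filter; apply: uniq_leq_size => [|al].
    exact: fset_uniq.
  rewrite in_fset_set; last by apply: sub_finite_set fZ => ? [].
  rewrite inE mem_filter => -[Zal /eqP ->] /=.
  by rewrite in_fset_set// inE.
rewrite ler_pdivrMr// (le_trans PC)// -mulrA ler_wpM2l//.
rewrite mulrDl mulVf ?gt_eqF// lerD2r.
rewrite (le_trans (enorm_le_sum _))// mulr_suml; apply: ler_sum => k _.
rewrite -[X in _ * X](gtr0_norm n0) -normrM mulrBl mulrAC mulVf ?gt_eqF// mul1r.
by rewrite !mxE summxE mulrC.
Qed.

Lemma average_error_cvg {R : realType} {m N : nat} {A : set 'rV[R]_m}
    {delta : nat -> R} {u_ : nat -> 'rV[R]_m -> 'rV[R]_N}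
    {u : 'rV[R]_m -> 'rV[R]_N} (C : R) : (0 < m)%N -> A !=set0 -> open A ->
  bounded_set A -> lipschitz_boundary A -> (forall j, 0 < delta j) ->
  delta @ \oo --> (0 : R) ->
  (forall j a, Zgrid (delta j) A a -> sphere (u_ j a)) ->
  weak_star_cvg A (fun j => pc_ext (delta j) (u_ j)) u ->
  (fun j => C * (\sum_(k < N) `|average A u 0 k -
     (card_set (Zgrid (delta j) A))%:R^-1 *
     (\sum_(a <- fset_set (Zgrid (delta j) A)) u_ j a 0 k)| +
     (card_set (Zgrid (delta j) A))%:R^-1)) @ \oo --> (0 : R).
Proof.
move=> m0 A0 oA bA lA d0 dcvg us uw.
rewrite -[X in _ --> X](mulr0 C) -[X in C * X](addr0 0).
apply: cvgM; first exact: cvg_cst.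
apply: cvgD; last exact: inv_card_Zgrid_cvg.
have kcvg k : (fun j => `|average A u 0 k -
     (card_set (Zgrid (delta j) A))%:R^-1 *
     (\sum_(a <- fset_set (Zgrid (delta j) A)) u_ j a 0 k)|) @ \oo --> (0 : R).
  rewrite -[X in _ --> X](@normr0 _ R) -[X in `|X|](subrr (average A u 0 k)).
  apply: cvg_norm; apply: cvgB; first exact: cvg_cst.
  exact: discrete_mean_cvg.
elim: (index_enum _) => [|k s IH].
  by under eq_fun do rewrite big_nil; exact: cvg_cst.
under eq_fun do rewrite big_cons.
by have := cvgD (kcvg k) IH; rewrite addr0; apply.
Qed.

(* With a single cell the discrete average is a unit vector, so its value is
   prescribed for every j with at least two cells, i.e. for all but finitely many
   j, since delta_j -> 0 and A is open and nonempty. *)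
Theorem lemma2 (R : realType) (m N : nat) (hm : (1 <= m)%N) (hN : (2 <= N)%N)
    (A : set 'rV[R]_m) (A0 : A !=set0) (oA : open A) (bA : bounded_set A)
    (lipA : lipschitz_boundary A)
    (delta : nat -> R) (delta_gt0 : forall j, 0 < delta j)
    (delta_cvg : delta @ \oo --> (0 : R))
    (u_ : nat -> 'rV[R]_m -> 'rV[R]_N)
    (u_sphere : forall j alpha, Zgrid (delta j) A alpha ->
       sphere (u_ j alpha))
    (u : 'rV[R]_m -> 'rV[R]_N) (u_ball : Linfty_ball A u)
    (u_cvg : weak_star_cvg A (fun j => pc_ext (delta j) (u_ j)) u)
    (u_avg : enorm (average A u) < 1) :
  exists (ut : nat -> 'rV[R]_m -> 'rV[R]_N) (P : nat -> nat),
    [/\ forall j alpha, Zgrid (delta j) A alpha -> sphere (ut j alpha),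
        forall j, (1 < card_set (Zgrid (delta j) A))%N ->
          daverage (delta j) A (ut j) = average A u,
        forall j, (card_set [set alpha | Zgrid (delta j) A alpha /\
                                         ut j alpha <> u_ j alpha]
                   <= 2 * P j)%N &
        (fun j => (P j)%:R / (card_set (Zgrid (delta j) A))%:R : R)
          @ \oo --> (0 : R)].
Proof.
have [C C0 mod] := exists_modification (average A u) hN u_avg.
have /choice[vP vPE] j := exists_modification_Zgrid A (delta j) (u_ j)
  (average A u) C (delta_gt0 j) bA C0 mod (u_sphere j).
exists (fun j => (vP j).1), (fun j => (vP j).2); split.
- by move=> j; have [] := vPE j.
- by move=> j; have [] := vPE j.
- by move=> j; have [] := vPE j.
apply: squeeze_cvgr (cvg_cst 0)
  (average_error_cvg C hm A0 oA bA lipA delta_gt0 delta_cvg u_sphere u_cvg).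
by near=> j; rewrite divr_ge0//=; have [] := vPE j.
Unshelve. all: by end_near.
Qed.
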